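(* Let $\{\Gamma_s\}_{s\in S}$, $|S|\geq2$, be a family of non-trivial groups, let $\Gamma=\ast_{s\in S}\Gamma_s$ be the associated free product, and let $\sigma=(\sigma_s)_{s\in S}\in V_0(\Gamma)$. Then the map $g_\sigma:\Gamma\to\mathbb{R}$ is a quasi-morphism.
   Context: A map $f:\Gamma\to\mathbb{R}$ on a group $\Gamma$ is a quasi-morphism if $\sup_{x,y\in\Gamma}|f(x)+f(y)-f(xy)|<\infty$. For a group $H$, $\widehat{C}^1_{\mathrm{b}}(H)$ denotes the space of bounded odd maps $f:H\to\mathbb{R}$, where odd means $f(x^{-1})=-f(x)$ for all $x\in H$. Set $V(\Gamma):=\prod_{s\in S}\widehat{C}^1_{\mathrm{b}}(\Gamma_s)$ and $V_0(\Gamma):=\{(\sigma_s)_{s\in S}\in V(\Gamma)\,;\,\sup_{s\in S}\|\sigma_s\|_\infty<\infty\}$. Each $\Gamma_s$ is identified with its image under the natural map $\Gamma_s\hookrightarrow\Gamma$. The factorization of $x\in\Gamma$ is the unique way of writing $x=x_0\cdots x_n$ with $x_i\in\Gamma_{s_i}$ non-trivial and $s_i\neq s_{i+1}$ for $0\le i<n$ (the neutral element has the empty factorization). For $\sigma\in V_0(\Gamma)$ and $x$ with this factorization, $g_\sigma(x)=\sum_{i=0}^n\sigma_{s_i}(x_i)$ (so $g_\sigma$ vanishes at the neutral element). *)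

(* Defs.v *)
From HB Require Import structures.
From mathcomp Require Import all_boot all_order all_algebra.
From mathcomp Require Import all_classical reals ereal.

Set Implicit Arguments.
Unset Strict Implicit.
Unset Printing Implicit Defensive.

Import Order.TTheory GRing.Theory Num.Theory.
Local Open Scope classical_set_scope.
Local Open Scope ring_scope.
Local Open Scope group_scope.

(* The free product of a family of groups is built by van der Waerden's method:
   its elements are the reduced words, and a letter acts on reduced words by
   left multiplication.  The group structure, the embeddings of the factors,
   the universal property and the existence and uniqueness of factorizations
   are all proved below. *)

Section FreeProduct.
Context {S : choiceType} (G : S -> groupType).

Definition letter := {s : S & G s}.

Implicit Types (a b : letter) (u v w : seq letter).

Definition reduced w :=
  all (fun a => tagged a != 1) w && sorted (fun a b => tag a != tag b) w.

Record freeprod := FreeProd {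
  factorization : seq letter;
  factorization_reduced : reduced factorization }.

HB.instance Definition _ := [isSub for factorization].
HB.instance Definition _ := [Choice of freeprod by <:].

(* Adds a letter in front of a word, omitting it if it is trivial. *)
Definition consw a w := if tagged a == 1 then w else a :: w.

(* The action of a letter on reduced words: the letter merges with the first
   letter of the word when both come from the same factor. *)
Definition lmulw a w :=
  if w is b :: w' then
    if tag b == tag a then consw (Tagged G (tagged a * tagged_as a b)) w'
    else consw a w
  else consw a [::].

Definition avoids (s : S) w := if w is b :: _ then tag b != s else true.

Lemma reduced_cons a w :
  reduced (a :: w) = [&& tagged a != 1, avoids (tag a) w & reduced w].
Proof.
rewrite /reduced /=; case: w => [|b w] /=; rewrite ?andbT // (eq_sym (tag b)).
by do !case: (_ != _) => //=; rewrite ?andbF.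
Qed.

Lemma consw_reduced a w : avoids (tag a) w -> reduced w -> reduced (consw a w).
Proof. by rewrite /consw; case: eqP => // /eqP a1 aw rw; rewrite reduced_cons a1 aw. Qed.

Lemma lmulw_consw s (g k : G s) w : avoids s w ->
  lmulw (Tagged G g) (consw (Tagged G k) w) = consw (Tagged G (g * k)) w.
Proof.
move=> aw; rewrite [consw (Tagged G k) w]/consw /=; case: eqP => [->|_] /=.
  by rewrite mulg1; case: w aw => //= b w /negPf ->.
by rewrite eqxx tagged_asE.
Qed.

Lemma split_reduced s w : reduced w ->
  exists k : G s, exists2 w', w = consw (Tagged G k) w' & avoids s w' /\ reduced w'.
Proof.
move=> rw; have [aw|] := boolP (avoids s w).
  by exists 1, w => //; rewrite /consw /= eqxx.
case: w rw => //= -[t k] w; rewrite reduced_cons /= => /and3P[k1 aw rw].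
rewrite negbK => /eqP st; case: s / st; exists k, w => //.
by rewrite /consw /= (negPf k1).
Qed.

Lemma lmulw_reduced a w : reduced w -> reduced (lmulw a w).
Proof.
case: a => s g /(split_reduced s)[k [w' -> [aw rw]]].
by rewrite -/(Tagged G g) lmulw_consw //; apply: consw_reduced.
Qed.

Lemma lmulw1 s w : reduced w -> lmulw (Tagged G (1 : G s)) w = w.
Proof.
by move=> /(split_reduced s)[k [w' -> [aw _]]]; rewrite lmulw_consw // mul1g.
Qed.

Lemma lmulwM s (g h : G s) w : reduced w ->
  lmulw (Tagged G (g * h)) w = lmulw (Tagged G g) (lmulw (Tagged G h) w).
Proof.
by move=> /(split_reduced s)[k [w' -> [aw _]]]; rewrite !lmulw_consw // mulgA.
Qed.

Definition mulw u v := foldr lmulw v u.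

Lemma mulw_reduced u v : reduced v -> reduced (mulw u v).
Proof. by move=> rv; elim: u => //= a u; apply: lmulw_reduced. Qed.

Lemma mulw_nil u : reduced u -> mulw u [::] = u.
Proof.
elim: u => //= a u IH; rewrite reduced_cons => /and3P[a1 au ru].
rewrite IH // /lmulw; case: u au {IH ru} => [|b u] /=; first by rewrite /consw (negPf a1).
by move/negPf->; rewrite /consw (negPf a1).
Qed.

Lemma mulw_lmulw a u v : reduced u -> reduced v ->
  mulw (lmulw a u) v = lmulw a (mulw u v).
Proof.
have conswE b w : reduced v -> mulw (consw b w) v = lmulw b (mulw w v).
  rewrite /consw; case: eqP => //=; case: b => s g /= -> rv.
  by rewrite (lmulw1 s) // mulw_reduced.
case: a => s g /(split_reduced s)[k [w' -> [aw _]]] rv.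
by rewrite -/(Tagged G g) lmulw_consw // !conswE // lmulwM // mulw_reduced.
Qed.

Lemma mulwA u v w : reduced v -> reduced w ->
  mulw u (mulw v w) = mulw (mulw u v) w.
Proof.
by move=> rv rw; elim: u => //= a u ->; rewrite mulw_lmulw // mulw_reduced.
Qed.

Definition invw w := rev [seq Tagged G (tagged a)^-1 | a : letter <- w].

Lemma invw_reduced w : reduced w -> reduced (invw w).
Proof.
rewrite /reduced /invw all_rev all_map rev_sorted sorted_map => /andP[w1 sw].
apply/andP; split; first by apply: sub_all w1 => a /=; rewrite invg_eq1.
by apply: sub_sorted sw => a b /=; rewrite eq_sym.
Qed.

Lemma mulVw u : reduced u -> mulw (invw u) u = [::].
Proof.
suff H w : reduced w -> mulw (invw u) (mulw u w) = w.
  by move=> ru; rewrite -{2}(mulw_nil ru) H.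
elim: u w => [|[s g] u IH] w rw //=.
rewrite /invw /= rev_cons -cats1 /mulw foldr_cat /= -/(Tagged G g).
by rewrite -lmulwM ?mulw_reduced // mulVg lmulw1 ?mulw_reduced //; apply: IH.
Qed.

Definition freeprod_one := @FreeProd [::] isT.
Definition freeprod_mul (x y : freeprod) :=
  FreeProd (mulw_reduced (factorization x) (factorization_reduced y)).
Definition freeprod_inv (x : freeprod) :=
  FreeProd (invw_reduced (factorization_reduced x)).

Fact freeprod_mulA : associative freeprod_mul.
Proof. by move=> x y z; apply/val_inj/mulwA; apply: factorization_reduced. Qed.

Fact freeprod_mul1 : left_id freeprod_one freeprod_mul.
Proof. by move=> x; apply/val_inj. Qed.

Fact freeprod_mulr1 : right_id freeprod_one freeprod_mul.
Proof. by move=> x; apply/val_inj/mulw_nil/factorization_reduced. Qed.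

Fact freeprod_mulV : left_inverse freeprod_one freeprod_inv freeprod_mul.
Proof. by move=> x; apply/val_inj/mulVw/factorization_reduced. Qed.

Fact freeprod_mulrV : right_inverse freeprod_one freeprod_inv freeprod_mul.
Proof.
move=> x; rewrite -[LHS]freeprod_mul1 -{1}(freeprod_mulV (freeprod_inv x)).
rewrite -freeprod_mulA (freeprod_mulA (freeprod_inv x)) freeprod_mulV.
by rewrite freeprod_mul1 freeprod_mulV.
Qed.

HB.instance Definition _ := isGroup.Build freeprod freeprod_mulA
  freeprod_mul1 freeprod_mulr1 freeprod_mulV freeprod_mulrV.

Fact freeprod_in_subproof s (g : G s) : reduced (consw (Tagged G g) [::]).
Proof. exact: consw_reduced. Qed.

Definition freeprod_in s (g : G s) := FreeProd (freeprod_in_subproof g).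

Lemma factorization_inM s (g : G s) (x : freeprod) :
  factorization (freeprod_in g * x) = lmulw (Tagged G g) (factorization x).
Proof.
rewrite /= /consw /=; case: eqP => //= ->.
by rewrite lmulw1 ?factorization_reduced.
Qed.

Fact freeprod_in_is_multiplicative s : {morph @freeprod_in s : g h / g * h}.
Proof.
move=> g h; apply/val_inj; rewrite [RHS]factorization_inM /=.
by rewrite lmulw_consw.
Qed.

HB.instance Definition _ s := isMultiplicative.Build (G s) freeprod
  (@freeprod_in s) (@freeprod_in_is_multiplicative s).

Lemma freeprod_in_inj s : injective (@freeprod_in s).
Proof.
move=> g h /(congr1 factorization) /=; rewrite /consw /=.
case: eqP => [->|_]; case: eqP => [->|_] // /(congr1 (head (Tagged G g))) /eqP.
by rewrite eq_Tagged => /eqP.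
Qed.

Lemma prod_factorization (x : freeprod) :
  \prod_(a <- factorization x) freeprod_in (tagged a) = x.
Proof.
apply/val_inj; rewrite /= -[RHS](mulw_nil (factorization_reduced x)).
elim: (factorization x) => [|[s g] w IH]; first by rewrite big_nil.
by rewrite big_cons factorization_inM IH.
Qed.

Lemma factorization_unique (x : freeprod) w : reduced w ->
  \prod_(a <- w) freeprod_in (tagged a) = x -> w = factorization x.
Proof.
by move=> rw; rewrite -[w]/(factorization (FreeProd rw)) prod_factorization => ->.
Qed.

Section Lift.
Context (H : groupType) (phi : forall s, {multiplicative G s -> H}).

Let evalw w := \prod_(a <- w) phi (tag a) (tagged a).

Definition freeprod_lift (x : freeprod) := evalw (factorization x).

Fact freeprod_lift_is_multiplicative : {morph freeprod_lift : x y / x * y}.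
Proof.
have phi1 s : phi s 1 = 1 by apply: (mulgI (phi s 1)); rewrite -gmulfM !mulg1.
have evalw_cons a w : evalw (consw a w) = phi (tag a) (tagged a) * evalw w.
  rewrite /consw; case: eqP => [->|_]; first by rewrite phi1 mul1g.
  by rewrite /evalw big_cons.
have evalw_lmulw a w : reduced w ->
    evalw (lmulw a w) = phi (tag a) (tagged a) * evalw w.
  case: a => s g /(split_reduced s)[k [w' -> [aw _]]].
  by rewrite -/(Tagged G g) lmulw_consw // !evalw_cons /= gmulfM mulgA.
move=> x y; rewrite /freeprod_lift /=.
elim: (factorization x) => [|a w IH]; first by rewrite {2}/evalw big_nil mul1g.
rewrite /= evalw_lmulw ?mulw_reduced ?factorization_reduced // IH mulgA.
by rewrite [evalw (a :: w)]big_cons.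
Qed.

Lemma freeprod_liftK s (g : G s) : freeprod_lift (freeprod_in g) = phi s g.
Proof.
rewrite /freeprod_lift /evalw /= /consw /=; case: eqP => [->|_].
  by rewrite big_nil; apply: (mulgI (phi s 1)); rewrite -gmulfM !mulg1.
by rewrite big_seq1.
Qed.

Lemma freeprod_lift_unique (psi : {multiplicative freeprod -> H}) :
  (forall s (g : G s), psi (freeprod_in g) = phi s g) -> psi =1 freeprod_lift.
Proof.
move=> psiE x; rewrite -{1}(prod_factorization x) /freeprod_lift /evalw.
have psi1 : psi 1 = 1 by apply: (mulgI (psi 1)); rewrite -gmulfM !mulg1.
elim: (factorization x) => [|a w IH]; first by rewrite !big_nil.
by rewrite !big_cons gmulfM IH psiE.
Qed.

End Lift.

End FreeProduct.

Local Close Scope group_scope.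

Section QuasiMorphisms.
Context {R : realType}.

Definition quasimorphism (H : groupType) (f : H -> R) : Prop :=
  (ereal_sup [set `|f p.1 + f p.2 - f (p.1 * p.2)%g|%:E | p in [set: H * H]]
    < +oo)%E.

Definition sup_norm (T : Type) (f : T -> R) : \bar R :=
  ereal_sup [set `|f x|%:E | x in [set: T]].

Definition odd_map (H : groupType) (f : H -> R) : Prop :=
  forall x : H, f x^-1%g = - f x.

Definition bounded_odd (H : groupType) : set (H -> R) :=
  [set f | (sup_norm f < +oo)%E /\ odd_map f].

Context {S : choiceType} (G : S -> groupType).

Definition V : set (forall s, G s -> R) :=
  [set sigma | forall s, bounded_odd (sigma s)].

Definition V0 : set (forall s, G s -> R) :=
  [set sigma | V sigma /\
    (ereal_sup [set sup_norm (sigma s) | s in [set: S]] < +oo)%E].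

(* The map written $g_\sigma$. *)
Definition split_sum (sigma : forall s, G s -> R) (x : freeprod G) : R :=
  \sum_(a <- factorization x) sigma (tag a) (tagged a).

End QuasiMorphisms.

(* Main.v *)
Require Import Defs.
From mathcomp Require Import all_boot all_order all_algebra.
From mathcomp Require Import all_classical reals.
From mathcomp Require Import ereal ring.

(** Multiply two reduced words [u] and [v].  At the junction the last letter of
    [u] meets the first letter of [v].  If they lie in different factors the
    product is the concatenation, and [split_sum] is exactly additive.  If they
    are mutually inverse they cancel, and since each [sigma s] is odd their
    contributions to the sum cancel too: the defect of [u], [v] is the defect of
    the two shorter words.  Otherwise they merge into a single non-trivial letter
    and no further reduction takes place, so the defect is the defect of a single
    [sigma s] at the two merging letters.  Hence (lemma [defect_mulw]) the defect
    of [split_sum sigma] is bounded by any common bound for the defects of the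
    [sigma s], and three times the uniform bound on the norms is such a bound. *)

Set Implicit Arguments.
Unset Strict Implicit.
Unset Printing Implicit Defensive.

Import Order.TTheory GRing.Theory Num.Theory.
Local Open Scope classical_set_scope.
Local Open Scope ring_scope.

Section ReducedWords.
Context {S : choiceType} (G : S -> groupType).
Implicit Types (a b : letter G) (u v w : seq (letter G)).

(** In this form the sorting condition visibly depends only on the factors the
    letters come from, so a letter may be replaced by another non-trivial one of
    the same factor. *)
Lemma reducedE w :
  reduced w = all (fun a => tagged a != 1%g) w
              && sorted (fun s t => s != t) [seq tag a | a <- w].
Proof. by rewrite /reduced sorted_map. Qed.

Lemma reduced_rcons_prefix u a : reduced (rcons u a) -> reduced u.
Proof.
rewrite !reducedE all_rcons map_rcons => /andP[/andP[_ ->]] /=.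
by case: u => //= b u; rewrite rcons_path => /andP[].
Qed.

Lemma reduced_junction u a v : reduced (rcons u a) -> reduced (a :: v) ->
  reduced (u ++ a :: v).
Proof.
rewrite /reduced all_rcons all_cat /= sorted_cat_cons.
by move=> /andP[/andP[_ ->] ->] /andP[/andP[-> ->] ->].
Qed.

Lemma reduced_merge u v s (g h : G s) : (g * h)%g != 1%g ->
  reduced (rcons u (Tagged G g)) -> reduced (Tagged G h :: v) ->
  reduced (u ++ Tagged G (g * h)%g :: v).
Proof.
move=> gh1 ru rv; apply: reduced_junction.
  move: ru; rewrite !reducedE !all_rcons !map_rcons /= gh1.
  by move=> /andP[/andP[_ ->] ->].
by move: rv; rewrite !reducedE /= gh1 => /andP[/andP[_ ->] ->].
Qed.

(** A reduced word sends the empty word to itself, and [u ++ v] acts on the empty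
    word as [v] followed by [u]. *)
Lemma mulw_cat u v : reduced (u ++ v) -> mulw u v = u ++ v.
Proof.
move=> ruv; rewrite -[RHS]mulw_nil // /mulw foldr_cat -/(mulw v [::]) mulw_nil //.
elim: u ruv => //= a u IH; rewrite reduced_cons => /and3P[_ _]; exact: IH.
Qed.

End ReducedWords.

Section Defect.
Context {R : realType} {S : choiceType} (G : S -> groupType).
Variables (sigma : forall s, G s -> R) (D : R).
Arguments sigma : clear implicits.
Hypothesis sigma_odd : forall s, odd_map (sigma s).
Hypothesis D_ge0 : 0 <= D.
Hypothesis sigma_defect : forall s (g h : G s),
  `|sigma s g + sigma s h - sigma s (g * h)%g| <= D.

Let sumw (w : seq (letter G)) := \sum_(a <- w) sigma (tag a) (tagged a).

(** Induction on [u] from its right end, which is where cancellation in [u * v]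
    takes place. *)
Lemma defect_mulw u v : reduced u -> reduced v ->
  `|sumw u + sumw v - sumw (mulw u v)| <= D.
Proof.
have sumw_cat w1 w2 : sumw (w1 ++ w2) = sumw w1 + sumw w2 by apply: big_cat.
have sumw_cons a w : sumw (a :: w) = sigma (tag a) (tagged a) + sumw w.
  by apply: big_cons.
have additive u' v' : reduced (u' ++ v') ->
    `|sumw u' + sumw v' - sumw (mulw u' v')| <= D.
  by move=> ruv; rewrite mulw_cat // sumw_cat subrr normr0.
elim/last_ind: u v => [|u a IH] v ru rv; first exact: additive.
case: v rv => [|b v] rv; first by apply: additive; rewrite cats0.
have [|ab] := eqVneq (tag a) (tag b); last first.
  apply: additive; rewrite cat_rcons; apply: reduced_junction => //.
  move: ru; rewrite (reduced_cons a) rv /= (eq_sym (tag b)) ab reducedE all_rcons.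
  by move=> /andP[/andP[-> _] _].
case: a b ru rv => s g [t h] ru rv /= st; case: t / st h rv => h rv.
rewrite -/(Tagged G g) -/(Tagged G h) in ru rv *.
(* The two letters merge before the rest of [u] acts. *)
have -> : mulw (rcons u (Tagged G g)) (Tagged G h :: v)
    = mulw u (consw (Tagged G (g * h)%g) v).
  by rewrite /mulw foldr_rcons /= eqxx tagged_asE.
rewrite -cats1 sumw_cat !sumw_cons /= [sumw [::]]big_nil addr0 /consw /=.
case: eqP => [gh1|/eqP gh1].
  (* Cancellation: by oddness the two values of [sigma s] cancel as well. *)
  have -> : h = g^-1%g by rewrite -[h](mulKg g) gh1 mulg1.
  rewrite sigma_odd addrA addrK.
  apply: IH; first exact: reduced_rcons_prefix ru.
  by move: rv; rewrite reduced_cons => /and3P[].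
(* Merging: everything but the defect of [sigma s] at [g], [h] cancels. *)
rewrite mulw_cat ?reduced_merge // sumw_cat sumw_cons /=.
suff -> : sumw u + sigma s g + (sigma s h + sumw v)
    - (sumw u + (sigma s (g * h)%g + sumw v))
    = sigma s g + sigma s h - sigma s (g * h)%g by [].
by ring.
Qed.

Lemma quasimorphism_split_sum : quasimorphism (split_sum sigma).
Proof.
apply: (@le_lt_trans _ _ D%:E); last exact: ltry.
apply: ge_ereal_sup => _ [[x y] _ <-]; rewrite lee_fin.
by apply: defect_mulw; apply: factorization_reduced.
Qed.

End Defect.

Lemma ereal_sup_lty_ub (R : realType) (A : set (\bar R)) :
  (ereal_sup A < +oo)%E -> exists C : R, forall y, A y -> (y <= C%:E)%E.
Proof.
move=> A_fin; exists (fine (ereal_sup A)) => y Ay.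
have := ereal_sup_ubound Ay; move: A_fin; case: (ereal_sup A) => //= _.
(* If the supremum is [-oo], every element of [A] is [-oo]. *)
by rewrite leeNy_eq => /eqP ->; apply: leNye.
Qed.

Lemma V0_bounded (R : realType) (S : choiceType) (G : S -> groupType)
    (sigma : forall s, G s -> R) :
  V0 sigma -> exists C : R, forall s (g : G s), `|sigma s g| <= C.
Proof.
move=> [_ /ereal_sup_lty_ub[C leC]]; exists C => s g; rewrite -lee_fin.
apply: le_trans (leC (sup_norm (sigma s)) _); last by exists s.
by apply: ereal_sup_ubound; exists g.
Qed.

Theorem proposition4p1 (R : realType) (S : choiceType) (G : S -> groupType)
    (S_ge2 : exists s t : S, s <> t)
    (G_nontrivial : forall s : S, exists x : G s, x <> 1%g)
    (sigma : forall s : S, G s -> R) (sigma_V0 : V0 sigma) :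
  quasimorphism (split_sum sigma).
Proof.
have [C leC] := V0_bounded sigma_V0; have [s0 _] := S_ge2.
have C_ge0 : 0 <= C := le_trans (normr_ge0 _) (leC s0 1%g).
apply: (@quasimorphism_split_sum _ _ _ _ (C + C + C)).
- by move=> s; case: sigma_V0 => /(_ s)[].
- by rewrite !addr_ge0.
- by move=> s g h; apply: le_trans (ler_normB _ _) _;
    rewrite lerD //; apply: le_trans (ler_normD _ _) _; rewrite lerD.
Qed.
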